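(* Let $\Pi$ be the set of positive integers coprime to $6$, and for $x\in\Pi$ let $M(x)=\frac{3x+1}{2^k}$ where $k\ge1$ is the unique integer making this odd. For $x_0\in\Pi$ let $x_m=M^m(x_0)$. Let $B>1$ be a real number such that $\log_B 2$ is irrational of finite type $\kappa<\infty$. Then for every $[a,b]\subset[0,1]$, $$\lim_{m\to\infty}\mathbb{P}\left(\left\{x_0\in\Pi:\ \log_B\left[\frac{x_m}{(3/4)^m x_0}\right]\bmod 1\in[a,b]\right\}\right)=b-a.$$ If instead $B=2^n$ for a positive integer $n$, then in the limit $m\to\infty$ the quantity $\log_B\left[\frac{x_m}{(3/4)^m x_0}\right]\bmod1$ takes the values $0,\frac1n,\dots,\frac{n-1}{n}$ with equal probability: for each $j\in\{0,\dots,n-1\}$ and each $0<\varepsilon<\frac{1}{2n}$, $\lim_{m\to\infty}\mathbb{P}\left(\left\{x_0\in\Pi:\ \left\|\log_B\left[\frac{x_m}{(3/4)^m x_0}\right]-\frac jn\right\|<\varepsilon\right\}\right)=\frac1n$, where $\|y\|$ is the distance from $y$ to the nearest integer.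
   Context: Here $M^m$ denotes the $m$-fold iterate. For $A\subset\Pi$, with $A_T=\{x\in A:x\le T\}$, the probability is the natural density $\mathbb{P}(A)=\lim_{T\to\infty}|A_T|/|\Pi_T|$ (the limit $T\to\infty$ is taken first, then $m\to\infty$). A real number $\alpha$ is of type $\kappa$ if $\kappa$ is the supremum of all $\gamma$ such that $\liminf_{q\to\infty}q^{\gamma+1}\min_{p\in\mathbb{Z}}|\alpha-p/q|=0$. *)

(* Defs.v *)
From HB Require Import structures.
From mathcomp Require Import all_boot all_order all_algebra.
From mathcomp Require Import all_classical all_reals all_analysis.

Set Implicit Arguments.
Unset Strict Implicit.
Unset Printing Implicit Defensive.

Import Order.TTheory GRing.Theory Num.Theory.
Import numFieldNormedType.Exports.

Local Open Scope classical_set_scope.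
Local Open Scope ring_scope.

Definition Pi6 : set nat := [set x | (0 < x)%N /\ coprime x 6].

Definition M3x1 (x : nat) : nat := ((3 * x + 1) %/ 2 ^ logn 2 (3 * x + 1))%N.

(* Pi6 is stable under M3x1, and there M3x1 x = (3x+1)/2^k for the unique
   k >= 1 such that this is an odd integer. *)
Lemma M3x1_spec (x : nat) : Pi6 x ->
  Pi6 (M3x1 x) /\
  exists k : nat, [/\ (1 <= k)%N, (M3x1 x * 2 ^ k = 3 * x + 1)%N &
    forall k' y : nat, odd y -> (y * 2 ^ k' = 3 * x + 1)%N ->
      k' = k /\ y = M3x1 x].
Proof.
move=> [x0 cx].
have p0 : (0 < 3 * x + 1)%N by rewrite addn1.
have ox : odd x.
  by move: cx; rewrite (coprimeMr x 2 3) => /andP[]; rewrite coprimen2.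
have k1 : (1 <= logn 2 (3 * x + 1))%N.
  by rewrite logn_gt0 mem_primes /= p0 /= dvdn2 oddD oddM ox.
have ME : (M3x1 x * 2 ^ logn 2 (3 * x + 1) = 3 * x + 1)%N.
  by rewrite /M3x1 divnK// pfactor_dvdnn.
have M0 : (0 < M3x1 x)%N.
  by rewrite lt0n; apply/eqP => M0; move: p0; rewrite -ME M0 mul0n.
have oM : odd (M3x1 x).
  rewrite -[odd _]negbK -dvdn2; apply/negP => /dvdnP[q Mq].
  have : (2 ^ (logn 2 (3 * x + 1)).+1 %| 3 * x + 1)%N.
    by rewrite -[X in (_ %| X)%N]ME Mq -mulnA -expnS dvdn_mull.
  by rewrite pfactor_dvdn// ltnn.
split.
  split=> //; rewrite (coprimeMr _ 2 3) coprimen2 oM /= coprime_sym.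
  rewrite prime_coprime//; apply/negP => d3.
  have : (3 %| 3 * x + 1)%N by rewrite -ME dvdn_mulr.
  by rewrite dvdn_addr// dvdn_mulr.
exists (logn 2 (3 * x + 1)); split => // k' y oy yE.
have y0 : (0 < y)%N by case: (y) oy.
have kE : k' = logn 2 (3 * x + 1).
  rewrite -yE lognM// ?expn_gt0// pfactorK//.
  by rewrite (_ : logn 2 y = 0%N)// logn_coprime// coprime2n.
split=> //; apply/eqP.
by rewrite -(eqn_pmul2r (expn_gt0 2 (logn 2 (3 * x + 1)))) ME -kE yE.
Qed.

Section Density.
Variable R : realType.

Definition count_upto (A : set nat) (T : nat) : nat :=
  #|[pred x : 'I_T.+1 | (x : nat) \in A]|.

Definition density_ratio (A : set nat) (T : nat) : R :=
  (count_upto A T)%:R / (count_upto Pi6 T)%:R.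

Definition has_prob (A : set nat) : Prop := cvg (density_ratio A @ \oo).

(* Meaningful only when has_prob A holds: lim is a default value otherwise. *)
Definition prob (A : set nat) : R := lim (density_ratio A @ \oo).

End Density.
Arguments has_prob : clear implicits.
Arguments prob : clear implicits.

Section Reals.
Variable R : realType.

Definition logb (B x : R) : R := ln x / ln B.

Definition mod1 (y : R) : R := y - (Num.floor y)%:~R.

Definition dist_int (y : R) : R := inf [set `|y - p%:~R| | p in [set: int]].

Definition dist_frac (alpha : R) (q : nat) : R :=
  inf [set `|alpha - p%:~R / q%:R| | p in [set: int]].

Definition dioph_type (alpha : R) : \bar R :=
  ereal_sup [set g%:E | g in [set g : R |
    limn_einf (fun q : nat => (q%:R `^ (g + 1) * dist_frac alpha q)%:E) = 0%E]].

Definition log_ratio (B : R) (m x0 : nat) : R :=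
  logb B ((iter m M3x1 x0)%:R / ((3%:R / 4%:R) ^+ m * x0%:R)).

End Reals.

(* Main.v *)
Require Import Defs.
From HB Require Import structures.
From mathcomp Require Import all_boot all_order all_algebra.
From mathcomp Require Import all_classical all_reals all_analysis.
From mathcomp Require Import zify ring lra.

Import Order.TTheory GRing.Theory Num.Theory.
Import numFieldNormedType.Exports.

Local Open Scope classical_set_scope.
Local Open Scope ring_scope.

(* Let K be the sum of the 2-adic exponents met in the first m steps from x.
   Then x_m 2^K = 3^m x + c with 0 < c bounded in terms of m and K only, so
   log_B (x_m / ((3/4)^m x)) = (2m - K) log_B 2 + t with t -> 0+ as x grows while
   K stays fixed.  Hence the density of each event is the mass of a set of values
   of K, under the exact law P(K = k) = C(k-1, m-1) / 2^k of a sum of m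
   independent geometric variables.  That law is unimodal with mode tending to 0,
   hence almost invariant under k |-> k + 1 as m grows.  An almost invariant law
   gives nearly equal mass to arcs of the circle that differ by a rotation through
   a small multiple of log_B 2, which by Dirichlet's pigeonhole argument is enough
   for equidistribution; for log_B 2 = 1/n the n residues are permuted cyclically. *)

(** * Sums of 2-adic exponents along an orbit *)

Definition oddpart (z : nat) : nat := (z %/ 2 ^ logn 2 z)%N.

Definition exponent_sum (m x : nat) : nat :=
  (\sum_(i < m) logn 2 (3 * iter i M3x1 x + 1))%N.

(** The number of halvings made by the Collatz process from [z] until [m] odd steps and the halvings
    after them are done. Allowing an even start lets the recursion proceed one halving at a time. *)
Definition stopping_sum (m z : nat) : nat :=
  (logn 2 z + exponent_sum m (oddpart z))%N.

Lemma exponent_sumSl m x :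
  exponent_sum m.+1 x = stopping_sum m (3 * x + 1)%N.
Proof.
rewrite /exponent_sum big_ord_recl /=; congr addn.
by apply: eq_bigr => i _; rewrite -iterS iterSr.
Qed.

Lemma stopping_sum_double m z : (0 < z)%N ->
  stopping_sum m (2 * z) = (stopping_sum m z).+1.
Proof.
move=> z0; have lE : logn 2 (2 * z) = (logn 2 z).+1 by rewrite lognM.
by rewrite /stopping_sum /oddpart lE expnS divnMl// addSn.
Qed.

Lemma logn2_odd z : odd z -> logn 2 z = 0%N.
Proof. by move=> oz; rewrite logn_coprime// coprime2n. Qed.

Lemma stopping_sum0_odd z : odd z -> stopping_sum 0 z = 0%N.
Proof.
by move=> oz; rewrite /stopping_sum logn2_odd// /exponent_sum big_ord0.
Qed.

Lemma stopping_sumS_odd m z : odd z ->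
  stopping_sum m.+1 z = (stopping_sum m (3 * z + 1)./2).+1.
Proof.
move=> oz; rewrite {1}/stopping_sum {1}/oddpart logn2_odd// expn0 divn1 add0n.
rewrite exponent_sumSl -stopping_sum_double; last by lia.
by congr stopping_sum; lia.
Qed.

(** * Counting functions on initial segments *)

Definition cnt (P : pred nat) (T : nat) : nat := count P (iota 0 T).

Lemma cntS P T : cnt P T.+1 = (cnt P T + P T)%N.
Proof. by rewrite /cnt -addn1 iotaD count_cat /= addn0. Qed.

Lemma cntD P T s : cnt P (T + s) = (cnt P T + \sum_(i < s) P (T + i))%N.
Proof.
elim: s => [|s IH]; first by rewrite addn0 big_ord0 addn0.
by rewrite addnS cntS IH big_ord_recr /= addnA.
Qed.

Lemma eq_cnt (P Q : pred nat) : P =1 Q -> cnt P =1 cnt Q.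
Proof. by move=> PQ T; apply: eq_count. Qed.

Lemma leq_cnt (P Q : pred nat) T : (forall x, P x -> Q x) -> (cnt P T <= cnt Q T)%N.
Proof. by move=> PQ; apply: sub_count. Qed.

Lemma cnt_mul P q T :
  cnt P (q * T) = (\sum_(i < q) cnt (fun s => P (q * s + i)) T)%N.
Proof.
elim: T => [|T IH]; first by rewrite muln0 big1.
rewrite mulnS addnC cntD IH -big_split /=.
by apply: eq_bigr => i _; rewrite cntS.
Qed.

Lemma cnt_add (P Q : pred nat) T : (forall x, P x -> ~~ Q x) ->
  cnt (predU P Q) T = (cnt P T + cnt Q T)%N.
Proof.
move=> PQ; elim: T => // T IH; rewrite !cntS IH /=.
by have := PQ T; case: (P T) => [/(_ isT)/negbTE ->|_] /=; lia.
Qed.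

Lemma cnt_eventually_le (P Q : pred nat) X T : (forall x, (X <= x)%N -> P x -> Q x) ->
  (cnt P T <= cnt Q T + X)%N.
Proof.
move=> PQ.
(* [minn X T] makes the bound inductive: the allowance grows only while [T] is below [X]. *)
suff : (cnt P T <= cnt Q T + minn X T)%N by lia.
elim: T => // T IH; rewrite !cntS.
have := PQ T; case: (leqP X T) => XT.
  by case: (P T) => [/(_ isT isT) ->|_]; lia.
by move=> _; lia.
Qed.

(** * Densities with bounded error, and the exact law of the exponent sum *)

Section BoundedDiscrepancy.
Variable R : realType.
Implicit Types (d : R) (P Q : pred nat).

(** Stronger than having density [d], and stable under the finite splittings below, so no limit is
    taken until [bounded_discrepancy_cvg]. *)
Definition bounded_discrepancy d P :=
  exists C : R, forall T, `|(cnt P T)%:R - d * T%:R| <= C.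

Lemma eq_bounded_discrepancy d P Q : P =1 Q ->
  bounded_discrepancy d P -> bounded_discrepancy d Q.
Proof.
by move=> PQ [C hC]; exists C => T; rewrite -(eq_cnt _ _ PQ).
Qed.

Lemma bounded_discrepancy0 : bounded_discrepancy 0 xpred0.
Proof.
by exists 0 => T; rewrite mul0r subr0 /cnt count_pred0 normr0.
Qed.

Lemma bounded_discrepancy1 : bounded_discrepancy 1 xpredT.
Proof.
by exists 0 => T; rewrite mul1r /cnt count_predT size_iota subrr normr0.
Qed.

(** Over complete blocks of length [q] the errors of the residue classes add up; the last,
    incomplete block costs at most [q] plus the absolute value of the total density. *)
Lemma bounded_discrepancy_modn (q : nat) P (d : nat -> R) : (0 < q)%N ->
  (forall i, (i < q)%N -> bounded_discrepancy (d i) (fun s => P (q * s + i)%N)) ->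
  bounded_discrepancy ((\sum_(i < q) d i) / q%:R) P.
Proof.
move=> q0 h.
(* A choice of one constant per class; the default 0 of [xget] never occurs, since each set of
   admissible constants is nonempty. *)
have [C hC] : exists C : nat -> R, forall i, (i < q)%N -> forall T,
    `|(cnt (fun s => P (q * s + i)%N) T)%:R - d i * T%:R| <= C i.
  have h' i : exists c : R, (i < q)%N -> forall T,
      `|(cnt (fun s => P (q * s + i)%N) T)%:R - d i * T%:R| <= c.
    by case: (ltnP i q) => [/h[c hc]|_]; [exists c|exists 0].
  by exists (fun i => xget 0 [set c | (i < q)%N -> forall T,
      `|(cnt (fun s => P (q * s + i)%N) T)%:R - d i * T%:R| <= c]) => i iq;
    case: xgetP => [c _ /(_ iq)//|]; have [c hc] := h' i => /(_ c).
set D := \sum_(i < q) d i.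
exists (\sum_(i < q) C i + q%:R + `|D|) => T.
have q0' : q%:R != 0 :> R by rewrite pnatr_eq0 -lt0n.
set n := (T %/ q)%N; set r := (T %% q)%N.
have TE : T = (q * n + r)%N by rewrite {1}(divn_eq T q) mulnC.
have rq : (r < q)%N by rewrite ltn_mod.
have E1 : `|(cnt P (q * n))%:R - D * n%:R| <= \sum_(i < q) C i.
  rewrite cnt_mul natr_sum mulr_suml -sumrB.
  apply: le_trans (ler_norm_sum _ _ _) _.
  by apply: ler_sum => i _; apply: hC.
have E2 : ((cnt P T)%:R - (cnt P (q * n))%:R : R) <= q%:R.
  rewrite TE cntD natrD addrAC subrr add0r ler_nat.
  apply: leq_trans (_ : (\sum_(i < r) 1 <= q)%N).
    by apply: leq_sum => i _; case: (P _).
  by rewrite sum1_card card_ord ltnW.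
have E3 : 0 <= ((cnt P T)%:R - (cnt P (q * n))%:R : R).
  by rewrite TE cntD natrD addrAC subrr add0r ler0n.
have -> : (cnt P T)%:R - D / q%:R * T%:R = (cnt P (q * n))%:R - D * n%:R
   + ((cnt P T)%:R - (cnt P (q * n))%:R) - D * (r%:R / q%:R).
  by rewrite {2}TE natrD natrM; field.
apply: le_trans (ler_normB _ _) _; apply: lerD.
  apply: le_trans (ler_normD _ _) _; apply: lerD => //.
  by rewrite ger0_norm.
rewrite normrM ler_piMr// ger0_norm ?divr_ge0//.
by rewrite ler_pdivrMr ?ltr0n// mul1r ler_nat ltnW.
Qed.

Lemma bounded_discrepancy_parity d0 d1 P :
  bounded_discrepancy d0 (fun s => P (2 * s)%N) ->
  bounded_discrepancy d1 (fun s => P (2 * s).+1) ->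
  bounded_discrepancy ((d0 + d1) / 2) P.
Proof.
move=> h0 h1.
have := @bounded_discrepancy_modn 2 P (fun i => if i is 0 then d0 else d1).
rewrite !big_ord_recl big_ord0 addr0 /=; apply => // -[|[|]]// _.
  by apply: eq_bounded_discrepancy h0 => s; rewrite addn0.
by apply: eq_bounded_discrepancy h1 => s; rewrite addn1.
Qed.

(* The density of [stopping_sum m z = k] in every progression of odd step. *)
Definition halving_law (m k : nat) : R := 'C(k, m)%:R / 2 ^+ k.+1.

Lemma halving_law0S k : halving_law 0 k.+1 = halving_law 0 k / 2.
Proof. by rewrite /halving_law !bin0 [2 ^+ k.+2]exprS; field; rewrite expf_neq0. Qed.

Lemma halving_lawS0 m : halving_law m.+1 0 = 0.
Proof. by rewrite /halving_law bin0n mul0r. Qed.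

Lemma halving_lawSS m k :
  halving_law m.+1 k.+1 = (halving_law m.+1 k + halving_law m k) / 2.
Proof.
rewrite /halving_law binS natrD [2 ^+ k.+2]exprS.
by field; rewrite expf_neq0.
Qed.

(* Exactly one parity class of [t] makes [w + v * t] even.  There one factor 2
   splits off; on the other class one applies [z |-> (3 z + 1) / 2].  Both
   leave a progression with odd step, which makes the induction go through. *)
Lemma stopping_sum_discrepancy m k w v : (0 < w)%N -> odd v ->
  bounded_discrepancy (halving_law m k) (fun t => stopping_sum m (w + v * t) == k).
Proof.
elim: k m w v => [|k IH] m w v w0 ov.
- have even0 z : (0 < z)%N -> ~~ odd z -> (stopping_sum m z == 0)%N = false.
    move=> z0 oz; rewrite (_ : z = 2 * z./2)%N; last by lia.
    by rewrite stopping_sum_double//; lia.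
  have odd0 z : odd z -> (stopping_sum m z == 0)%N = (m == 0)%N.
    move=> oz; case: m {even0} => [|m]; first by rewrite stopping_sum0_odd.
    by rewrite stopping_sumS_odd.
  have -> : halving_law m 0 = (0 + (m == 0)%N%:R) / 2.
    by rewrite /halving_law bin0n add0r expr1.
  have dm : bounded_discrepancy (m == 0)%N%:R (fun _ => (m == 0)%N).
    case: (m == 0)%N; first exact: bounded_discrepancy1.
    exact: bounded_discrepancy0.
  have [ow|ew] := boolP (odd w).
    rewrite addrC; apply: bounded_discrepancy_parity.
      by apply: eq_bounded_discrepancy dm => s; rewrite odd0//; lia.
    apply: eq_bounded_discrepancy bounded_discrepancy0 => s.
    by rewrite even0//; lia.
  apply: bounded_discrepancy_parity.
    apply: eq_bounded_discrepancy bounded_discrepancy0 => s.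
    by rewrite even0//; lia.
  by apply: eq_bounded_discrepancy dm => s; rewrite odd0//; lia.
(* The law on the odd class: for [m = 0] an odd start has sum 0, never [k.+1]; otherwise one odd
   step and one halving are spent. *)
- pose d := if m is m'.+1 then halving_law m' k else 0.
  have -> : halving_law m k.+1 = (halving_law m k + d) / 2.
    by rewrite /d; case: m {d} => [|m]; rewrite ?addr0 ?halving_law0S ?halving_lawSS.
  have evenP w' (P : pred nat) : (0 < w')%N ->
     (forall s, P s = (stopping_sum m (2 * (w' + v * s)) == k.+1)%N) ->
     bounded_discrepancy (halving_law m k) P.
    move=> w'0 hP; apply: eq_bounded_discrepancy (IH m w' v w'0 ov) => s.
    by rewrite hP stopping_sum_double ?eqSS//; lia.
  have oddP w' (P : pred nat) : odd w' ->
     (forall s, P s = (stopping_sum m (w' + 2 * (v * s)) == k.+1)%N) ->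
     bounded_discrepancy d P.
    move=> ow' hP; rewrite /d; case: m hP {d evenP} => [|m] hP.
      apply: eq_bounded_discrepancy bounded_discrepancy0 => s.
      by rewrite hP stopping_sum0_odd//; lia.
    have w'0 : (0 < (3 * w' + 1)./2)%N by lia.
    have o3 : odd (3 * v) by lia.
    apply: eq_bounded_discrepancy (IH m _ _ w'0 o3) => s.
    rewrite hP stopping_sumS_odd; last by lia.
    by rewrite eqSS; congr (stopping_sum _ _ == _); lia.
  have [ow|ew] := boolP (odd w).
    rewrite addrC; apply: bounded_discrepancy_parity.
      by apply: (oddP w) => // s; congr (stopping_sum _ _ == _); lia.
    apply: (evenP ((w + v)./2)) => [|s]; first by lia.
    by congr (stopping_sum _ _ == _); lia.
  apply: bounded_discrepancy_parity.
    apply: (evenP (w./2)) => [|s]; first by lia.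
    by congr (stopping_sum _ _ == _); lia.
  by apply: (oddP (w + v)%N) => [|s]; [lia|congr (stopping_sum _ _ == _); lia].
Qed.

(* [halving_law] with both indices shifted, since the first step from an odd
   number always has exponent at least 1. *)
Definition exponent_law (m k : nat) : R :=
  match m, k with
  | 0, k => (k == 0)%N%:R
  | m'.+1, 0 => 0
  | m'.+1, k'.+1 => halving_law m' k'
  end.

(** On a class [6 s + w] with [w] odd, [3 x + 1] is twice a term of a progression with odd step 9,
    so [stopping_sum_discrepancy] applies. Two of the six classes are coprime to 6, whence the
    factor 1/3. *)
Lemma exponent_sum_discrepancy m k : bounded_discrepancy (exponent_law m k / 3)
  (fun x => coprime x 6 && (exponent_sum m x == k)).
Proof.
have key w : (0 < w)%N -> odd w -> bounded_discrepancy (exponent_law m k)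
    (fun s => exponent_sum m (6 * s + w) == k).
  move=> w0 ow; case: m => [|m].
    rewrite /exponent_law /exponent_sum.
    have [->|k0] := eqVneq k 0%N.
      by apply: eq_bounded_discrepancy bounded_discrepancy1 => s; rewrite big_ord0.
    apply: eq_bounded_discrepancy bounded_discrepancy0 => s.
    by rewrite big_ord0 eq_sym (negbTE k0).
  have E s : exponent_sum m.+1 (6 * s + w)
      = (stopping_sum m ((3 * w + 1)./2 + 9 * s)).+1.
    rewrite exponent_sumSl -stopping_sum_double; last by lia.
    by congr stopping_sum; lia.
  case: k => [|k] /=.
    by apply: eq_bounded_discrepancy bounded_discrepancy0 => s; rewrite E.
  have w'0 : (0 < (3 * w + 1)./2)%N by lia.
  apply: eq_bounded_discrepancy (stopping_sum_discrepancy m k _ 9 w'0 isT) => s.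
  by rewrite E eqSS.
have cE s i : coprime (6 * s + i) 6 = coprime i 6.
  by rewrite -(coprime_modl (6 * s + i)) mulnC modnMDl coprime_modl.
have -> : exponent_law m k / 3 = (\sum_(i < 6)
    (if coprime i 6 then exponent_law m k else 0)) / 6%:R.
  rewrite !big_ord_recl big_ord0 /= /bump /=; by field.
apply: (bounded_discrepancy_modn 6 _
  (fun i => if coprime i 6 then exponent_law m k else 0)) => // i i6.
case: (boolP (coprime i 6)) => ci.
  apply: eq_bounded_discrepancy (key i _ _) => [s||]; first by rewrite cE ci.
  - by case: i ci {i6}.
  - by move: ci; rewrite (coprimeMr _ 2 3) coprimen2 => /andP[].
by apply: eq_bounded_discrepancy bounded_discrepancy0 => s; rewrite cE (negbTE ci).
Qed.

Lemma coprime6_discrepancy : bounded_discrepancy 3^-1 (fun x => coprime x 6).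
Proof.
have := exponent_sum_discrepancy 0 0; rewrite /= mul1r.
apply: eq_bounded_discrepancy => s.
by rewrite /exponent_sum big_ord0 eqxx andbT.
Qed.

End BoundedDiscrepancy.

(** * Fractional parts *)

Section Mod1.
Variable R : realType.
Implicit Types (y u v : R) (z : int).

Lemma mod1_itv y : 0 <= mod1 y < 1.
Proof.
rewrite /mod1; have /andP[h1 h2] := floor_itv y.
by rewrite subr_ge0 h1 /= ltrBlDl; rewrite intrD in h2.
Qed.

Lemma mod1_small y : 0 <= y < 1 -> mod1 y = y.
Proof.
by move=> h; rewrite /mod1 (@floor_def _ y 0) ?subr0// add0r.
Qed.

Lemma mod1Dz y z : mod1 (y + z%:~R) = mod1 y.
Proof.
by rewrite /mod1 floorDrz ?intr_int// intrKfloor intrD opprD addrACA subrr addr0.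
Qed.

Lemma mod1E y : exists z, y = mod1 y + z%:~R.
Proof. by exists (Num.floor y); rewrite /mod1 subrK. Qed.

Lemma mod1B y u : u <= mod1 y -> 0 <= u -> mod1 (y - u) = mod1 y - u.
Proof.
move=> uy u0; have [z yE] := mod1E y; have /andP[y0 y1] := mod1_itv y.
by rewrite {1}yE addrAC mod1Dz mod1_small//; lra.
Qed.

Lemma mod1D y u : mod1 y + u < 1 -> 0 <= u -> mod1 (y + u) = mod1 y + u.
Proof.
move=> uy u0; have [z yE] := mod1E y; have /andP[y0 y1] := mod1_itv y.
by rewrite {1}yE addrAC mod1Dz mod1_small//; lra.
Qed.

(** Cuts the arc [[0, u + v)] at [u]. This direction also holds when [u + v] exceeds 1; the converse
    [mod1_lt_addr] needs an arc that does not overlap itself. *)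
Lemma mod1_lt_add y u v : 0 <= u -> mod1 y < u + v ->
  (mod1 y < u) || (mod1 (y - u) < v).
Proof.
move=> u0 h; case: ltP => //= uy; rewrite mod1B//; lra.
Qed.

Lemma mod1_lt_addr y u v : 0 <= u -> u + v <= 1 -> mod1 (y - u) < v ->
  u <= mod1 y < u + v.
Proof.
move=> u0 uv h; have /andP[h0 _] := mod1_itv (y - u).
have := @mod1D (y - u) u _ u0; rewrite subrK => -> //; lra.
Qed.

End Mod1.

(** * Equidistribution of almost invariant laws on the circle *)

Section Equidistribution.
Variable R : realType.
Implicit Types (S : pred int -> R) (e f : pred int) (t l beta delta : R).

(** A finitely additive probability on the integers. The index is [int], not [nat], because the
    shift realising a small rotation may be negative. *)
Record almost_invariant (eps : R) S : Prop := AlmostInvariant {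
  ai_ge0 : forall e, 0 <= S e;
  ai_predT : S xpredT = 1;
  ai_predU : forall e f, (forall k, e k -> ~~ f k) ->
    S (predU e f) = S e + S f;
  ai_succ : forall e, `|S (fun k => e (k + 1)) - S e| <= eps }.

(** Half-open, so that adjacent arcs are disjoint; in terms of the point [k beta] the arc starts at
    [- t]. *)
Definition arc beta t l : pred int := fun k => mod1 (k%:~R * beta + t) < l.

Section Functional.
Variables (eps : R) (S : pred int -> R).
Hypothesis aiS : almost_invariant eps S.

Let eqS e f : e =1 f -> S e = S f.
Proof. by move=> /funext ->. Qed.

Lemma ai_pred0 : S xpred0 = 0.
Proof.
have := ai_predU _ _ aiS xpred0 xpred0 (fun _ _ => isT).
by rewrite (eqS _ xpred0)// => /eqP; rewrite -subr_eq subrr => /eqP.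
Qed.

Lemma ai_le e f : (forall k, e k -> f k) -> S e <= S f.
Proof.
move=> ef; rewrite (_ : S f = S (predU e (predD f e))).
  rewrite (ai_predU _ _ aiS) ?lerDl ?(ai_ge0 _ _ aiS)// => k /= ->.
  by [].
by apply: eqS => k /=; have := ef k; case: (e k) => //= ->.
Qed.

Lemma ai_le_predU e f : S (predU e f) <= S e + S f.
Proof.
rewrite (_ : S (predU e f) = S (predU e (predD f e))).
  rewrite (ai_predU _ _ aiS) ?lerD2l; last by move=> k /= ->.
  by apply: ai_le => k /andP[].
by apply: eqS => k /=; case: (e k).
Qed.

Lemma ai_shift_nat e (n : nat) :
  `|S (fun k => e (k + n%:Z)) - S e| <= n%:R * eps.
Proof.
elim: n => [|n IH].
  rewrite mul0r (_ : S _ = S e) ?subrr ?normr0//.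
  by apply: eqS => k; rewrite addr0.
rewrite (_ : S _ = S (fun k => (fun k => e (k + n%:Z)) (k + 1))); last first.
  by apply: eqS => k; congr e; lia.
have := ai_succ _ _ aiS (fun k => e (k + n%:Z)).
move: IH; rewrite -natr1 mulrDl mul1r !ler_norml; lra.
Qed.

Lemma ai_shift e (j : int) :
  `|S (fun k => e (k + j)) - S e| <= `|j|%N%:R * eps.
Proof.
case: j => n; first exact: ai_shift_nat.
rewrite NegzE abszN absz_nat distrC.
apply: le_trans (ai_shift_nat (fun k => e (k - n.+1%:Z)) n.+1).
rewrite (_ : S (fun k => e (k + n.+1%:Z - n.+1%:Z)) = S e)//.
by apply: eqS => k; rewrite addrK.
Qed.

Lemma ai_arcD beta t u v : 0 <= u -> 0 <= v -> u + v <= 1 ->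
  S (arc beta t (u + v)) = S (arc beta t u) + S (arc beta (t - u) v).
Proof.
move=> u0 v0 uv; rewrite -(ai_predU _ _ aiS).
  apply: eqS => k; rewrite /arc /= addrA; apply/idP/idP.
    exact: mod1_lt_add.
  move=> /orP[h|/mod1_lt_addr]; first lra.
  by case/(_ u0 uv)/andP.
move=> k; rewrite /arc addrA => h; apply/negP => /mod1_lt_addr.
by case/(_ u0 uv)/andP; lra.
Qed.

Lemma ai_arc_le_add beta t u v : 0 <= u ->
  S (arc beta t (u + v)) <= S (arc beta t u) + S (arc beta (t - u) v).
Proof.
move=> u0; apply: le_trans (ai_le_predU _ _); apply: ai_le => k.
by rewrite /arc /= addrA; apply: mod1_lt_add.
Qed.

Section Step.
Variables (beta delta : R) (j z : int).
Hypothesis jE : j%:~R * beta = delta + z%:~R.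

(** Replacing [k] by [k - n j] rotates the circle by [- n delta], the integer [n z] being invisible
    modulo 1; this takes [n |j|] unit shifts. *)
Lemma ai_arc_translate t l (n : nat) :
  `|S (arc beta (t - n%:R * delta) l) - S (arc beta t l)|
    <= n%:R * `|j|%N%:R * eps.
Proof.
rewrite (_ : n%:R * `|j|%N%:R = `|- (n%:Z * j)|%N%:R); last first.
  by rewrite abszN abszM natrM.
apply: le_trans (ai_shift _ _); rewrite (_ : S (arc beta (_ - _) _) =
  S (fun k => arc beta t l (k - n%:Z * j)))//.
apply: eqS => k; rewrite /arc; congr (_ < _).
rewrite -(mod1Dz _ _ (- (n%:Z * z))) !intrD !intrN !intrM !mulrDl !mulNr.
by rewrite -[_ * _ * beta]mulrA jE mulrDr opprD; congr mod1; rewrite -!pmulrn; ring.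
Qed.

Hypotheses (delta0 : 0 <= delta) (eps0 : 0 <= eps).

Let err (n : nat) := n%:R * n%:R * `|j|%N%:R * eps.

(** The long arc is covered by [n] translates of the short one. The translate by [i delta] costs
    [i |j| eps], and [err n] bounds the sum of these over [i < n]. *)
Lemma ai_arc_mul_le t (n : nat) :
  S (arc beta t (n%:R * delta)) <= n%:R * S (arc beta t delta) + err n.
Proof.
rewrite /err; elim: n => [|n IH].
  rewrite !mul0r addr0 (eqS _ xpred0) ?ai_pred0// => k; rewrite /arc.
  by case/andP: (mod1_itv _ (k%:~R * beta + t)) => h _; rewrite ltNge h.
rewrite -natr1 [(n%:R + 1) * delta]mulrDl mul1r.
apply: le_trans (ai_arc_le_add _ _ _ _ _) _; first by rewrite mulr_ge0.
have := ai_arc_translate t delta n; rewrite ler_norml => /andP[_].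
have : 0 <= n%:R * (`|j|%N%:R * eps) by rewrite !mulr_ge0.
have : 0 <= `|j|%N%:R * eps by rewrite mulr_ge0.
move: IH; rewrite -!mulrA; move: (`|j|%N%:R * eps) => c; nra.
Qed.

(** As long as the translates fit in one turn of the circle they are disjoint, so their masses add
    exactly. *)
Lemma ai_arc_mul_ge t (n : nat) : n%:R * delta <= 1 ->
  n%:R * S (arc beta t delta) <= S (arc beta t (n%:R * delta)) + err n.
Proof.
rewrite /err; elim: n => [|n IH] h.
  by rewrite !mul0r addr0 (ai_ge0 _ _ aiS).
move: h; rewrite -natr1 [(n%:R + 1) * delta]mulrDl mul1r => h.
have nd0 : 0 <= n%:R * delta by rewrite mulr_ge0.
have /IH {}IH : n%:R * delta <= 1 by apply: le_trans h; rewrite lerDl.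
rewrite ai_arcD//.
have := ai_arc_translate t delta n; rewrite ler_norml => /andP[+ _].
have : 0 <= n%:R * (`|j|%N%:R * eps) by rewrite !mulr_ge0.
have : 0 <= `|j|%N%:R * eps by rewrite mulr_ge0.
move: IH; rewrite -!mulrA; move: (`|j|%N%:R * eps) => c; nra.
Qed.

End Step.
End Functional.

Lemma arc_full beta t : arc beta t 1 = xpredT.
Proof.
by apply/funext => k; rewrite /arc; case/andP: (mod1_itv _ (k%:~R * beta + t)).
Qed.

Lemma small_multiple beta (eta : R) : irrational beta -> 0 < eta ->
  exists (j z : int) delta, 0 < delta < eta /\ j%:~R * beta = delta + z%:~R.
Proof.
move=> irr eta0.
have [n0 hn] : exists n : nat, eta^-1 < n%:R.
  by exists (Num.truncn eta^-1).+1; rewrite truncnS_gt.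
have n0' : (0 < n0)%N.
  by rewrite -(ltr_nat R); apply: lt_trans hn; rewrite invr_gt0.
case: n0 hn n0' => // n hn _.
(* Dirichlet's boxes: [n.+2] multiples of [beta] fall into [n.+1] intervals of length below
   [eta]. *)
pose c (i : 'I_n.+2) : 'I_n.+1 :=
  inord (Num.truncn (n.+1%:R * mod1 (i%:R * beta))).
have cE i : ((c i)%:R <= n.+1%:R * mod1 (i%:R * beta) < (c i).+1%:R).
  have /andP[m0 m1] := mod1_itv _ (i%:R * beta).
  have h0 : 0 <= n.+1%:R * mod1 (i%:R * beta) by rewrite mulr_ge0.
  rewrite /c inordK; first exact: truncn_itv.
  by rewrite truncn_lt_nat// gtr_pMr ?ltr0n.
have /injectivePn[i [i' ii' cii']] : ~~ injectiveb c.
  by apply/negP => /injectiveP/leq_card; rewrite !card_ord ltnn.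
have [zi iE] := mod1E _ (i%:R * beta).
have [zi' iE'] := mod1E _ (i'%:R * beta).
(* Equal fractional parts of two distinct multiples would make [beta] rational. *)
have ne : mod1 (i%:R * beta) != mod1 (i'%:R * beta).
  apply/eqP => eqm; apply: irr.
  exists ((zi - zi')%:~R / ((i : nat)%:Z - (i' : nat)%:Z)%:~R) => //.
  rewrite fmorph_div/= !ratr_int.
  have d0 : ((i : nat)%:Z - (i' : nat)%:Z)%:~R != 0 :> R.
    by rewrite intr_eq0 subr_eq0; apply: contra ii' => /eqP[] /val_inj ->.
  apply: (mulIf d0); rewrite divfK// !intrB mulrBr -!pmulrn.
  by rewrite ![beta * _]mulrC {1}iE {1}iE' eqm; ring.
have main (x x' : 'I_n.+2) (y y' : int) : c x = c x' ->
    x%:R * beta = mod1 (x%:R * beta) + y%:~R ->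
    x'%:R * beta = mod1 (x'%:R * beta) + y'%:~R ->
    mod1 (x%:R * beta) < mod1 (x'%:R * beta) ->
  exists (j z : int) delta, 0 < delta < eta /\ j%:~R * beta = delta + z%:~R.
  move=> cc xE xE' lt.
  exists ((x' : nat)%:Z - (x : nat)%:Z), (y' - y),
    (mod1 (x'%:R * beta) - mod1 (x%:R * beta)); split; last first.
    by rewrite !intrB mulrBl -!pmulrn {1}xE {1}xE'; ring.
  have := cE x; have := cE x'; rewrite cc -[(c x').+1%:R]natr1.
  move=> /andP[_ h1] /andP[h2 _].
  have hn1 : 1 < n.+1%:R * eta by rewrite -ltr_pdivrMr// div1r.
  have n1 : 0 < n.+1%:R :> R by rewrite ltr0n.
  rewrite subr_gt0 lt /= -(ltr_pM2l n1); lra.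
case: (ltgtP (mod1 (i%:R * beta)) (mod1 (i'%:R * beta))) => [lt|lt|eqm].
- exact: main cii' iE iE' lt.
- exact: main (esym cii') iE' iE lt.
- by rewrite eqm eqxx in ne.
Qed.

(** About [1 / delta] disjoint translates of a short arc fit in the circle, so its mass is at most
    about [delta]; an arc of length [l] is covered by about [l / delta] of them. *)
Lemma equidistribution_le beta (eta : R) : irrational beta -> 0 < eta ->
  exists2 eps, 0 < eps & forall S, almost_invariant eps S ->
    forall t l, 0 <= l <= 1 -> S (arc beta t l) <= l + eta.
Proof.
move=> irr eta0.
(* The final estimate is [l + 8 delta], hence [eta / 8]; the bound 1/2 keeps [1 - delta] away from
   0. *)
have [|j [z [delta [/andP[d0 dlt] jE]]]] :=
  small_multiple _ (Num.min (1 / 2) (eta / 8)) irr.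
  by rewrite lt_min; apply/andP; split; lra.
move: dlt; rewrite lt_min => /andP[dhalf deta].
pose N := Num.truncn (delta^-1).
have /andP[N1 N2] : N%:R <= delta^-1 < N.+1%:R.
  by apply: truncn_itv; rewrite invr_ge0 ltW.
have Nd1 : N%:R * delta <= 1 by rewrite -ler_pdivlMr// div1r.
have Nd2 : 1 < N.+1%:R * delta by rewrite -ltr_pdivrMr// div1r.
(* With [eps = delta / M], every [err n] with [n <= N.+1] is at most [delta]; the [+ 1] makes [M]
   positive whatever [j] is. *)
pose M : R := N.+1%:R * N.+1%:R * (`|j|%N%:R + 1).
have M0 : 0 < M by rewrite !mulr_gt0 ?ltr0n// ltr_wpDl.
exists (delta / M); first by rewrite divr_gt0.
move=> S aiS t l /andP[l0 l1].
have e0 : 0 <= delta / M by rewrite ltW ?divr_gt0.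
have err n : (n <= N.+1)%N -> n%:R * n%:R * `|j|%N%:R * (delta / M) <= delta.
  move=> nN; rewrite mulrCA ler_piMr ?(ltW d0)// ler_pdivrMr// mul1r /M.
  by rewrite !ler_pM ?mulr_ge0 ?ler_nat// lerDl.
pose n := (Num.truncn (l / delta)).+1.
have /andP[n1 n2] : (Num.truncn (l / delta))%:R <= l / delta < n%:R.
  by apply: truncn_itv; rewrite divr_ge0 // ltW.
have nN : (n <= N.+1)%N.
  by rewrite ltnS; apply: le_truncn; rewrite ler_pdivrMr// mulVf ?gt_eqF.
have nd1 : n%:R * delta <= l + delta.
  by rewrite -natr1 mulrDl mul1r lerD2r -ler_pdivlMr.
have nd2 : l < n%:R * delta by rewrite -ltr_pdivrMr.
have A : S (arc beta t l) <= S (arc beta t (n%:R * delta)).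
  by apply: (ai_le _ _ aiS) => k; rewrite /arc; lra.
have B := ai_arc_mul_le _ _ aiS _ _ _ _ jE (ltW d0) e0 t n.
have C := ai_arc_mul_ge _ _ aiS _ _ _ _ jE (ltW d0) e0 t N Nd1.
have D : S (arc beta t (N%:R * delta)) <= 1.
  by rewrite -(ai_predT _ _ aiS); apply: (ai_le _ _ aiS).
have errn := err n nN; have errN := err N (leqnSn N).
move: A B C D errn errN Nd2; rewrite -[N.+1%:R]natr1.
have := ai_ge0 _ _ aiS (arc beta t delta).
move: (S (arc beta t delta)) (S (arc beta t l)) => s x s0 A B C D errn errN Nd2.
have Ns : N%:R * s <= 1 + delta by lra.
have ns0 : 0 <= n%:R * s by rewrite mulr_ge0.
(* Regroup [n s (N delta)] as [(n delta) (N s)], using [N delta > 1 - delta]. *)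
have E : n%:R * s * (1 - delta) <= (l + delta) * (1 + delta).
  apply: (@le_trans _ _ ((n%:R * delta) * (N%:R * s))).
    have -> : n%:R * delta * (N%:R * s) = n%:R * s * (N%:R * delta) by ring.
    by apply: ler_wpM2l => //; lra.
  by apply: ler_pM => //; rewrite mulr_ge0// ltW.
have xs : x <= n%:R * s + delta by lra.
suff : n%:R * s <= l + 7 * delta by lra.
move: E ns0; move: (n%:R * s) => y E y0.
(* A crude bound, fed back into [E] as [y <= (l + delta) (1 + delta) + y delta] to reach
   [7 delta]. *)
have y5 : y <= 9 / 2 by nra.
nra.
Qed.

(** The lower bound is the upper bound for the complementary arc. *)
Lemma equidistribution beta (eta : R) : irrational beta -> 0 < eta ->
  exists2 eps, 0 < eps & forall S, almost_invariant eps S ->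
    forall t l, 0 <= l <= 1 -> `|S (arc beta t l) - l| <= eta.
Proof.
move=> irr eta0; have [eps eps0 h] := equidistribution_le _ _ irr eta0.
exists eps => // S aiS t l /andP[l0 l1].
have h1 : S (arc beta t l) <= l + eta by apply: h => //; apply/andP.
have h2 : S (arc beta (t - l) (1 - l)) <= 1 - l + eta.
  by apply: h => //; apply/andP; split; lra.
have h3 : 1 = S (arc beta t l) + S (arc beta (t - l) (1 - l)).
  rewrite -(ai_arcD _ _ aiS)//; [|lra|lra].
  by rewrite (addrC l) subrK arc_full (ai_predT _ _ aiS).
rewrite ler_norml; lra.
Qed.

(** The shift by -1 rotates by exactly [1 / n], and [n] such arcs tile the circle: [n] times the
    mass is within [n ^ 2 eps] of 1. *)
Lemma equidistribution_cyclic (eps : R) S (n : nat) t : (0 < n)%N -> 0 <= eps ->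
  almost_invariant eps S ->
  `|S (arc (- n%:R^-1) t n%:R^-1) - n%:R^-1| <= n%:R * eps.
Proof.
move=> n0 e0 aiS; have n0' : 0 < n%:R :> R by rewrite ltr0n.
have jE : (-1)%:~R * - n%:R^-1 = n%:R^-1 + 0%:~R :> R by rewrite mulrNN mul1r addr0.
have d0 : 0 <= n%:R^-1 :> R by rewrite invr_ge0.
have nn : n%:R * n%:R^-1 = 1 :> R by rewrite mulfV ?gt_eqF.
have := ai_arc_mul_le _ _ aiS _ _ _ _ jE d0 e0 t n.
have := ai_arc_mul_ge _ _ aiS _ _ _ _ jE d0 e0 t n.
rewrite nn arc_full (ai_predT _ _ aiS) abszN1 mulr1 => /(_ (lexx _)).
set s := S _ => h1 h2.
rewrite -(ler_pM2l n0') -[X in X * `|_|](@gtr0_norm _ n%:R)// -normrM.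
rewrite mulrBr nn ler_norml mulrA; lra.
Qed.

End Equidistribution.

(** * Probability laws on the natural numbers and their total variation *)

Section Mass.
Variable R : realType.
Implicit Types (p : nat -> R) (e f : pred nat).

Definition is_law p :=
  (forall k, 0 <= p k) /\ (\sum_(k < N) p k @[N --> \oo] --> (1 : R)).

Definition mass p e : R := limn (fun N => \sum_(k < N) p k * (e k)%:R).

Lemma mass_cvg p e : is_law p ->
  \sum_(k < N) p k * (e k)%:R @[N --> \oo] --> mass p e.
Proof.
move=> [p0 p1].
have nd : nondecreasing_seq (fun N => \sum_(k < N) p k).
  by apply/nondecreasing_seqP => N; rewrite big_ord_recr /= lerDl.
have le1 N : \sum_(k < N) p k <= 1.
  rewrite -[leRHS](cvg_lim _ p1)//; apply: nondecreasing_cvgn_le => //.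
  by apply/cvg_ex; exists (1 : R).
apply: nondecreasing_is_cvgn.
  by apply/nondecreasing_seqP => N; rewrite big_ord_recr /= lerDl mulr_ge0.
exists 1 => _ [N _ <-]; apply: le_trans (le1 N); apply: ler_sum => k _.
by rewrite ler_piMr// lern1 leq_b1.
Qed.

Lemma mass_eqP p e l : is_law p ->
  \sum_(k < N) p k * (e k)%:R @[N --> \oo] --> l -> mass p e = l.
Proof. by move=> lp h; apply: cvg_lim. Qed.

Lemma mass_predT p : is_law p -> mass p xpredT = 1.
Proof.
move=> lp; apply: mass_eqP => //; under eq_fun do under eq_bigr do rewrite mulr1.
by case: lp.
Qed.

Lemma mass_predU p e f : is_law p -> (forall k, e k -> ~~ f k) ->
  mass p (predU e f) = mass p e + mass p f.
Proof.
move=> lp ef; apply: mass_eqP => //.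
rewrite (_ : (fun N => _) = (fun N => \sum_(k < N) p k * (e k)%:R) \+
    (fun N => \sum_(k < N) p k * (f k)%:R)).
  exact: cvgD (mass_cvg _ e lp) (mass_cvg _ f lp).
apply/funext => N /=.
rewrite -big_split /=; apply: eq_bigr => k _; rewrite -mulrDr /=.
have := ef k; case: (e k) => /= [/(_ isT)/negbTE ->|_]; first by rewrite addr0.
by rewrite add0r.
Qed.

Lemma mass_predC p e : is_law p -> mass p (predC e) = 1 - mass p e.
Proof.
move=> lp; have ee k : e k -> ~~ predC e k by move=> /= ->.
rewrite -(mass_predT p lp).
have -> : mass p xpredT = mass p e + mass p (predC e).
  rewrite -(mass_predU p e (predC e) lp ee); congr (mass p _).
  by apply/funext => k /=; rewrite orbN.
by rewrite addrAC subrr add0r.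
Qed.

(** Summation by parts: the two masses differ by the sum of [(p k - p k.+1)] over the event, up to
    the boundary term [p 0], the jump from the negative integers. *)
Lemma mass_almost_invariant p (C : R) : is_law p ->
  (forall N, p 0%N + \sum_(k < N) `|p k - p k.+1| <= C) ->
  almost_invariant R C (fun e : pred int => mass p (fun k => e k%:Z)).
Proof.
move=> lp hC; have p0 := lp.1; split.
- move=> e; apply: (cvgr_to_ge (mass_cvg _ _ lp)); near=> N.
  by apply: sumr_ge0 => k _; rewrite mulr_ge0.
- exact: mass_predT.
- move=> e f ef; rewrite -mass_predU//= => k; exact: ef.
- move=> e.
  have A := mass_cvg _ (fun k => e (k%:Z + 1)) lp.
  have B := mass_cvg _ (fun k => e k%:Z) lp.
  rewrite -cvg_shiftS in B.
  apply: (cvgr_to_le (cvg_norm (cvgB A B))); near=> N => /=.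
  apply: le_trans (hC N).
  rewrite -[X in `|X| <= _]/(\sum_(k < N) p k * (e (k%:Z + 1))%:R -
    \sum_(k < N.+1) p k * (e k%:Z)%:R).
  rewrite big_ord_recl opprD addrCA.
  apply: le_trans (ler_normD _ _) _; apply: lerD.
    rewrite normrN normrM !ger0_norm// ler_piMr//.
    by rewrite lern1 leq_b1.
  rewrite -sumrB; apply: le_trans (ler_norm_sum _ _ _) _; apply: ler_sum => k _.
  rewrite /= (_ : k.+1%:Z = k%:Z + 1); last by lia.
  rewrite -mulrBl normrM ler_piMr// normr_nat.
  by rewrite lern1 leq_b1.
Unshelve. all: by end_near. Qed.

(** The variation telescopes on each side of the mode: a rise from 0 to [p c], then a fall of at
    most [p c]. *)
Lemma unimodal_variation p (c : nat) : (forall k, 0 <= p k) ->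
  (forall k, (k < c)%N -> p k <= p k.+1) ->
  (forall k, (c <= k)%N -> p k.+1 <= p k) ->
  forall N, p 0%N + \sum_(k < N) `|p k - p k.+1| <= 2 * p c.
Proof.
move=> p0 up down N.
have A n : (n <= c)%N -> p 0%N + \sum_(k < n) `|p k - p k.+1| = p n.
  elim: n => [_|n IH nc]; first by rewrite big_ord0 addr0.
  rewrite big_ord_recr /= addrA IH ?(ltnW nc)// ler0_norm ?subr_le0 ?up//; ring.
have B n : p 0%N + \sum_(k < c + n) `|p k - p k.+1| = 2 * p c - p (c + n)%N.
  elim: n => [|n IH]; first by rewrite addn0 A//; ring.
  rewrite addnS big_ord_recr /= addrA IH ger0_norm ?subr_ge0 ?down ?leq_addr//.
  ring.
case: (leqP N c) => [Nc|/ltnW/subnKC <-]; last by rewrite B gerBl.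
apply: le_trans (_ : p c <= _); last by rewrite mulr_natl mulr2n lerDl.
rewrite -[leRHS](A c)// lerD2l -[in leRHS](subnKC Nc) big_split_ord /= lerDl.
by apply: sumr_ge0.
Qed.

End Mass.

(** * Total mass, mode and decay of the exponent law *)

Section ExponentLaw.
Variable R : realType.
Local Notation halving_law := (halving_law R).
Local Notation exponent_law := (exponent_law R).

Lemma halving_law_ge0 m k : 0 <= halving_law m k.
Proof. by rewrite /halving_law divr_ge0// exprn_ge0. Qed.

Lemma sum_halving_lawS m N :
  \sum_(k < N.+1) halving_law m.+1 k =
  (\sum_(k < N) halving_law m.+1 k + \sum_(k < N) halving_law m k) / 2.
Proof.
rewrite big_ord_recl halving_lawS0 add0r -big_split mulr_suml /=.
by apply: eq_bigr => k _; rewrite halving_lawSS.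
Qed.

Lemma sum_halving_law0 N : \sum_(k < N) halving_law 0 k = 1 - 2^-1 ^+ N.
Proof.
elim: N => [|N IH]; first by rewrite big_ord0 expr0 subrr.
rewrite big_ord_recr /= IH /halving_law bin0 div1r -exprVn exprS; lra.
Qed.

Lemma sum_halving_law_le1 m N : \sum_(k < N) halving_law m k <= 1.
Proof.
elim: N m => [|N IH] [|m]; rewrite ?big_ord0//.
  by rewrite sum_halving_law0 gerBl exprn_ge0// invr_ge0.
rewrite sum_halving_lawS; have := IH m; have := IH m.+1; lra.
Qed.

(** The recursion in [m] forces the total mass [l] to satisfy [l = (l + 1) / 2]. *)
Lemma halving_law_is_law m : is_law R (halving_law m).
Proof.
split=> [k|]; first exact: halving_law_ge0.
elim: m => [|m IH].
  under eq_fun do rewrite sum_halving_law0.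
  have : 2^-1 ^+ N @[N --> \oo] --> (0 : R).
    by apply: cvg_expr; rewrite ger0_norm ?invr_ge0//; lra.
  by move=> /(cvgB (cvg_cst (1 : R))); rewrite subr0.
have [l hl] : exists l : R, \sum_(k < N) halving_law m.+1 k @[N --> \oo] --> l.
  apply/cvg_ex; apply: nondecreasing_is_cvgn.
    apply/nondecreasing_seqP => N; rewrite big_ord_recr /= lerDl.
    exact: halving_law_ge0.
  by exists 1 => _ [N _ <-]; apply: sum_halving_law_le1.
have hl2 : \sum_(k < N.+1) halving_law m.+1 k @[N --> \oo] --> (l + 1) / 2.
  under eq_fun do rewrite sum_halving_lawS.
  by apply: cvgM; [apply: cvgD|apply: cvg_cst].
have hl1 : \sum_(k < N.+1) halving_law m.+1 k @[N --> \oo] --> l.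
  by have := hl; rewrite -cvg_shiftS.
have lE : l = (l + 1) / 2.
  by rewrite -[RHS](cvg_lim (@norm_hausdorff _ _) hl2) (cvg_lim _ hl1).
by have <- : l = 1 by lra.
Qed.

Lemma exponent_law_is_law m : is_law R (exponent_law m).
Proof.
case: m => [|m]; split.
- by move=> k; rewrite /= ler0n.
- have E N : \sum_(k < N.+1) exponent_law 0 k = 1.
    by rewrite big_ord_recl /= big1 ?addr0// => i _.
  rewrite -cvg_shiftS (_ : [sequence _]_n = cst 1); first exact: cvg_cst.
  by apply/funext => N; apply: E.
- by case=> [|k] //=; apply: halving_law_ge0.
- have E N : \sum_(k < N.+1) exponent_law m.+1 k = \sum_(k < N) halving_law m k.
    by rewrite big_ord_recl /= add0r.
  rewrite -cvg_shiftS (_ : [sequence _]_n = fun N => \sum_(k < N) halving_law m k).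
    by have [] := halving_law_is_law m.
  by apply/funext => N; apply: E.
Qed.

(** The ratio of consecutive values is [(k + 1) / (2 (k + 1 - m))], which passes 1 at [k + 1 = 2 m];
    this locates the mode. *)
Lemma mul_halving_law m k :
  (k.+1 - m)%N%:R * (2 * halving_law m k.+1) = k.+1%:R * halving_law m k.
Proof.
rewrite /halving_law [2 ^+ k.+2]exprS invfM.
have := mul_bin_down k.+1 m => /(congr1 (fun n => n%:R : R)); rewrite !natrM /= => E.
rewrite [RHS]mulrA E; field; rewrite expf_neq0//.
Qed.

Lemma halving_law_up m k : (k < 2 * m)%N -> halving_law m k <= halving_law m k.+1.
Proof.
move=> km; have [kltm|mk] := ltnP k m.
  by rewrite {1}/halving_law bin_small// mul0r halving_law_ge0.
have h := mul_halving_law m k; have q0 := halving_law_ge0 m k.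
have d0 : 0 < (k.+1 - m)%N%:R :> R by rewrite ltr0n subn_gt0.
have /(ler_wpM2r q0) : (k.+1 - m)%N%:R * 2 <= k.+1%:R :> R.
  by rewrite -natrM ler_nat; lia.
by rewrite -h -(ler_pM2l d0 (halving_law _ _)); lra.
Qed.

Lemma halving_law_down m k : (2 * m <= k)%N -> halving_law m k.+1 <= halving_law m k.
Proof.
move=> mk.
have h := mul_halving_law m k; have q0 := halving_law_ge0 m k.
have d0 : 0 < (k.+1 - m)%N%:R :> R by rewrite ltr0n; lia.
have /(ler_wpM2r q0) : k.+1%:R <= (k.+1 - m)%N%:R * 2 :> R.
  by rewrite -natrM ler_nat; lia.
by rewrite -h -(ler_pM2l d0 (halving_law _ _)); lra.
Qed.

(** Equal to ['C(2 m, m) / 4 ^ m]: twice the modal value, as in [unimodal_variation]. *)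
Definition central_ratio (m : nat) : R := 2 * halving_law m (2 * m).

Lemma exponent_law_variation m N :
  exponent_law m.+1 0 + \sum_(k < N) `|exponent_law m.+1 k - exponent_law m.+1 k.+1|
    <= central_ratio m.
Proof.
apply: (@unimodal_variation R (exponent_law m.+1) (2 * m).+1).
- by have [] := exponent_law_is_law m.+1.
- by case=> [_|k] /=; [apply: halving_law_ge0|apply: halving_law_up].
- by case=> // k; apply: halving_law_down.
Qed.

(** Gives [central_ratio m <= 1 / sqrt (2 m + 1)] without square roots. The induction closes because
    [(2 m + 1) (2 m + 3) <= 4 (m + 1) ^ 2]. *)
Lemma central_binomial_le m : ('C(2 * m, m) ^ 2 * (2 * m).+1 <= 16 ^ m)%N.
Proof.
elim: m => [|m IH]; first by rewrite muln0 bin0.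
have E1 := mul_bin_diag (2 * m.+1) m.
have E2 := mul_bin_down (2 * m).+1 m.
rewrite (_ : (2 * m.+1).-1 = (2 * m).+1) in E1; last by lia.
rewrite /= (_ : ((2 * m).+1 - m = m.+1)%N) in E2; last by lia.
move: IH E1 E2; rewrite [(16 ^ m.+1)%N]expnS.
move: 'C(2 * m, m) 'C((2 * m).+1, m) 'C(2 * m.+1, m.+1) => a b c.
move: (16 ^ m)%N => X IH E1 E2.
have E3 : (m.+1 * c = 2 * (2 * m).+1 * a)%N.
  by rewrite -E1 -mulnA -E2 mulnA.
rewrite -(leq_pmul2l (_ : 0 < m.+1 ^ 2)%N)//.
have -> : (m.+1 ^ 2 * (c ^ 2 * (2 * m.+1).+1) = 4 * (2 * m).+1 * (2 * m + 3) *
   (a ^ 2 * (2 * m).+1))%N.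
  rewrite mulnA -expnMn E3 !expnMn; lia.
apply: leq_trans (leq_mul (leqnn _) IH) _.
rewrite [leqRHS]mulnA leq_mul2r; apply/orP; right; nia.
Qed.

Lemma central_ratio_cvg : central_ratio m @[m --> \oo] --> (0 : R).
Proof.
apply/cvgrPdist_le => eps eps0.
near=> m.
have c0 : 0 <= central_ratio m by rewrite mulr_ge0// halving_law_ge0.
rewrite sub0r normrN ger0_norm//.
have : central_ratio m ^+ 2 * (2 * m).+1%:R <= 1.
  have -> : central_ratio m = 'C(2 * m, m)%:R / 2 ^+ (2 * m).
    rewrite /central_ratio /halving_law [2 ^+ (2 * m).+1]exprS.
    by field; rewrite expf_neq0.
  have -> : 2 ^+ (2 * m) = 4 ^+ m :> R by rewrite exprM; congr (_ ^+ m); ring.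
  rewrite expr_div_n mulrAC ler_pdivrMr ?exprn_gt0// mul1r exprAC.
  rewrite (_ : 4 ^+ 2 = 16); last by ring.
  by rewrite -!natrX -natrM ler_nat central_binomial_le.
have : eps^-1 ^+ 2 <= m%:R by near: m; apply: nbhs_infty_ger.
move=> hm hc; rewrite leNgt; apply/negP => ce.
have : eps ^+ 2 * (2 * m).+1%:R <= 1.
  by apply: le_trans hc; rewrite ler_wpM2r// lerXn2r ?nnegrE// ltW.
apply/negP; rewrite -ltNge.
have e20 : 0 < eps ^+ 2 by rewrite exprn_gt0.
rewrite -ltr_pdivrMl// mulr1 -exprVn; apply: le_lt_trans hm _.
by rewrite ltr_nat; lia.
Unshelve. all: by end_near. Qed.

End ExponentLaw.

(** * Size of the iterates *)

Lemma M3x1_mul x : (M3x1 x * 2 ^ logn 2 (3 * x + 1) = 3 * x + 1)%N.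
Proof. by rewrite /M3x1 divnK// pfactor_dvdnn. Qed.

Lemma exponent_sumS m x :
  exponent_sum m.+1 x = (exponent_sum m x + logn 2 (3 * iter m M3x1 x + 1))%N.
Proof. by rewrite /exponent_sum big_ord_recr. Qed.

(** The summand [(0 < m)], read as 0 or 1, records that the additive drift is strictly positive
    after one step; the upper bound on the drift is deliberately crude. *)
Lemma iter_M3x1_bounds m x :
  (3 ^ m * x + (0 < m) <= iter m M3x1 x * 2 ^ exponent_sum m x
     <= 3 ^ m * x + 4 ^ m * 2 ^ exponent_sum m x)%N.
Proof.
elim: m => [|m /andP[IH1 IH2]].
  by rewrite /exponent_sum big_ord0 /= !expn0 addn0 mul1n muln1 leqnn leq_addr.
have -> : (iter m.+1 M3x1 x * 2 ^ exponent_sum m.+1 x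
    = (3 * iter m M3x1 x + 1) * 2 ^ exponent_sum m x)%N.
  by rewrite exponent_sumS expnD mulnCA iterS M3x1_mul mulnC.
rewrite exponent_sumS expnD.
have p0 : (0 < 2 ^ exponent_sum m x)%N by rewrite expn_gt0.
have q0 : (0 < 2 ^ logn 2 (3 * iter m M3x1 x + 1))%N by rewrite expn_gt0.
move: IH1 IH2 p0 q0; rewrite !expnS.
have : (0 < 4 ^ m)%N by rewrite expn_gt0.
move: (2 ^ exponent_sum m x)%N (3 ^ m)%N (4 ^ m)%N => a c d.
move: (2 ^ logn _ _)%N => b; move: (iter m M3x1 x) => y d0 h1 h2 a0 b0.
apply/andP; split; first by nia.
have : (4 * d * a <= 4 * d * (a * b))%N by rewrite leq_mul2l leq_pmulr// orbT.
nia.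
Qed.

(** * From the law of the exponent sum to natural densities *)

Section Density.
Variable R : realType.

Lemma log_ratio_near (B : R) m k (eta : R) : 1 < B -> 0 < eta ->
  exists X, forall x, (X <= x)%N -> Pi6 x -> exponent_sum m x = k ->
  exists t : R, [/\ log_ratio B m x = ((2 * m)%:R - k%:R) * logb B 2 + t,
    0 <= t < eta & (0 < m)%N -> 0 < t].
Proof.
move=> B1 eta0; have lnB : 0 < ln B by rewrite ln_gt0.
(* Beyond this threshold [r - 1 < eta * ln B], and [ln r <= r - 1] then gives [logb B r < eta]. *)
pose C : R := 4 ^+ m * 2 ^+ k / (ln B * eta).
exists (Num.truncn C).+1 => x hx [x0 _] Kk.
have Cx : C < x%:R.
  by apply: lt_le_trans (truncnS_gt C) _; rewrite ler_nat.
have /andP[b1 b2] := iter_M3x1_bounds m x; rewrite Kk in b1 b2.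
set y := iter m M3x1 x in b1 b2 *.
pose r : R := y%:R * 2 ^+ k / (3 ^+ m * x%:R).
have x0' : 0 < x%:R :> R by rewrite ltr0n.
have D0 : 0 < 3 ^+ m * x%:R :> R by rewrite mulr_gt0 ?exprn_gt0.
have n1 : 3 ^+ m * x%:R + (0 < m)%N%:R <= y%:R * 2 ^+ k :> R.
  by rewrite -!natrX -!natrM -natrD ler_nat.
have n2 : y%:R * 2 ^+ k <= 3 ^+ m * x%:R + 4 ^+ m * 2 ^+ k :> R.
  by rewrite -!natrX -!natrM -natrD ler_nat.
have y0 : 0 < y%:R :> R.
  have : 0 < y%:R * 2 ^+ k :> R by apply: lt_le_trans n1; rewrite ltr_wpDr.
  by rewrite pmulr_lgt0// exprn_gt0.
have r1 : 1 <= r.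
  by rewrite /r ler_pdivlMr// mul1r; apply: le_trans n1; rewrite lerDl.
have r0 : 0 < r by apply: lt_le_trans r1.
have r2 : r - 1 < eta * ln B.
  have : r - 1 <= 4 ^+ m * 2 ^+ k / (3 ^+ m * x%:R).
    by rewrite lerBlDl ler_pdivrMr// mulrDl mul1r divfK ?gt_eqF.
  move=> /le_lt_trans; apply.
  rewrite ltr_pdivrMr//; move: Cx; rewrite /C ltr_pdivrMr ?mulr_gt0// => Cx.
  apply: lt_le_trans Cx _; rewrite [leRHS]mulrC [_ * eta]mulrC.
  rewrite ler_wpM2r ?mulr_ge0 ?(ltW lnB) ?(ltW eta0)//.
  by rewrite ler_peMl ?(ltW x0')// exprn_ege1// ler1n.
exists (logb B r); split.
- rewrite /log_ratio -/y /logb.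
  have -> : y%:R / ((3%:R / 4%:R) ^+ m * x%:R) = r * (2 ^+ (2 * m) / 2 ^+ k) :> R.
    rewrite /r expr_div_n (exprM 2 2 m) (_ : 2 ^+ 2 = 4 :> R); last by ring.
    by field; rewrite !expf_neq0 ?gt_eqF.
  clearbody r.
  rewrite lnM ?posrE ?divr_gt0 ?exprn_gt0// ln_div ?posrE ?exprn_gt0//.
  rewrite !lnXn// -[_ *+ (2 * m)]mulr_natl -[_ *+ k]mulr_natl; field.
  by rewrite gt_eqF.
- rewrite /logb; apply/andP; split; first by rewrite divr_ge0 ?ln_ge0// ltW.
  rewrite ltr_pdivrMr//.
  apply: le_lt_trans r2.
  have := @le_ln1Dx R (r - 1); rewrite [1 + _]addrC subrK; apply; lra.
- move=> m0; rewrite /logb divr_gt0// ln_gt0// /r ltr_pdivlMr// mul1r.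
  by apply: lt_le_trans n1; rewrite m0 ltrDl.
Qed.

Lemma bounded_discrepancy_add (d d' : R) (P Q : pred nat) :
  (forall x, P x -> ~~ Q x) ->
  bounded_discrepancy R d P -> bounded_discrepancy R d' Q ->
  bounded_discrepancy R (d + d') (predU P Q).
Proof.
move=> PQ [C hC] [C' hC']; exists (C + C') => T.
rewrite cnt_add// natrD mulrDl opprD addrACA.
by apply: le_trans (ler_normD _ _) _; apply: lerD.
Qed.

Lemma bounded_discrepancy_ge (d : R) (P : pred nat) X :
  bounded_discrepancy R d P ->
  bounded_discrepancy R d (fun x => P x && (X <= x)%N).
Proof.
move=> [C hC]; exists (C + X%:R) => T.
have h1 : (cnt P T <= cnt (fun x => P x && (X <= x)%N) T + X)%N.
  by apply: cnt_eventually_le => x -> ->.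
have h2 : (cnt (fun x => P x && (X <= x)%N) T <= cnt P T)%N.
  by apply: leq_cnt => x /andP[].
move: h1 h2 (hC T); rewrite -!(ler_nat R) natrD !ler_norml; lra.
Qed.

Lemma bounded_discrepancy_cvg (d : R) (P : pred nat) :
  bounded_discrepancy R d P -> (cnt P T.+1)%:R / T.+1%:R @[T --> \oo] --> d.
Proof.
move=> [C hC]; apply/cvgrPdist_le => eps eps0; near=> T.
have T0 : 0 < T.+1%:R :> R by rewrite ltr0n.
rewrite -(ler_pM2r T0) -[X in _ * X <= _]gtr0_norm// -normrM mulrBl.
rewrite divfK ?gt_eqF// distrC; apply: le_trans (hC _) _.
rewrite -ler_pdivrMl//; apply: (@le_trans _ _ T%:R); last by rewrite ler_nat.
by near: T; apply: nbhs_infty_ger.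
Unshelve. all: by end_near. Qed.

Lemma in_Pi6 : (fun x => x \in Pi6) =1 (fun x => coprime x 6).
Proof.
move=> x; apply/idP/idP => [|cx]; first by rewrite inE => -[].
by rewrite inE; split=> //; case: x cx.
Qed.

Lemma count_uptoE A T : count_upto A T = cnt (fun x => x \in A) T.+1.
Proof.
rewrite /count_upto /cnt cardE /enum_mem size_filter -enumT -val_enum_ord count_map.
exact: eq_count.
Qed.

Lemma coprime6_cnt_gt0 T : (0 < T)%N -> (0 < cnt (fun x => coprime x 6) T.+1)%N.
Proof.
by case: T.
Qed.

(** The factor 1/3 is the density of [Pi6] itself and cancels in the quotient. *)
Lemma density_ratio_cvg (d : R) (A : set nat) :
  bounded_discrepancy R (d / 3) (fun x => x \in A) ->
  density_ratio R A @ \oo --> d.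
Proof.
move=> /bounded_discrepancy_cvg hA.
have hP := bounded_discrepancy_cvg _ _ (coprime6_discrepancy R).
have n3 : (3^-1 : R) != 0 by rewrite invr_eq0.
have -> : density_ratio R A = fun T => (cnt (fun x => x \in A) T.+1)%:R / T.+1%:R *
    ((cnt (fun x => coprime x 6) T.+1)%:R / T.+1%:R)^-1.
  apply/funext => T; rewrite /density_ratio !count_uptoE (eq_cnt _ _ in_Pi6).
  by rewrite invf_div mulrA divfK// pnatr_eq0.
rewrite -[d](divfK (_ : 3 != 0)) ?pnatr_eq0// -[X in _ * X]invrK.
exact: cvgM hA (cvgV n3 hP).
Qed.

Lemma density_ratio_le (A A' : set nat) T : A `<=` A' ->
  density_ratio R A T <= density_ratio R A' T.
Proof.
move=> AA'; rewrite /density_ratio ler_wpM2r ?invr_ge0// ler_nat !count_uptoE.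
by apply: leq_cnt => x; rewrite !inE; apply: AA'.
Qed.

Lemma density_ratio_setD (A : set nat) T : A `<=` Pi6 -> (0 < T)%N ->
  density_ratio R (Pi6 `\` A) T = 1 - density_ratio R A T.
Proof.
move=> AP T0; have c0 : (count_upto Pi6 T)%:R != 0 :> R.
  by rewrite pnatr_eq0 count_uptoE (eq_cnt _ _ in_Pi6) -lt0n coprime6_cnt_gt0.
apply/eqP; rewrite eq_sym subr_eq; apply/eqP.
rewrite /density_ratio -mulrDl -natrD addnC !count_uptoE -cnt_add; last first.
  by move=> x; rewrite !inE => Ax; apply/negP; rewrite inE => -[].
rewrite (eq_cnt _ (fun x => x \in Pi6)); first by rewrite -count_uptoE divff.
move=> x /=; apply/idP/idP.
  by move=> /orP[]; rewrite !inE; [exact: AP|case].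
rewrite inE => Px; have [Ax|Ax] := pselect (A x).
  by apply/orP; left; rewrite inE.
by apply/orP; right; rewrite inE.
Qed.

(** The threshold [X] may depend on [k]: the error in the logarithm is small only once [x] is large
    compared with [2 ^ k]. *)
Definition decided_by (m : nat) (e : pred nat) (A : set nat) := forall k,
  exists X, forall x, (X <= x)%N -> Pi6 x -> exponent_sum m x = k -> (A x <-> e k).

(** Truncating to sums below [N] loses little mass and leaves finitely many fibres, for which one
    threshold serves. *)
Lemma density_ratio_lower m e A (eps : R) : decided_by m e A -> 0 < eps ->
  \forall T \near \oo, mass R (exponent_law R m) e - eps <= density_ratio R A T.
Proof.
move=> hA eps0.
have e20 : 0 < eps / 2 by rewrite divr_gt0.
have lp := exponent_law_is_law R m.
have /cvgrPdist_le/(_ _ e20)[N _ /(_ N (leqnn N))/=] := mass_cvg R _ e lp.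
set s := \sum_(k < N) _ => hN.
pose Q N x := coprime x 6 && ((exponent_sum m x < N) && e (exponent_sum m x))%N.
have bQ : bounded_discrepancy R (s / 3) (Q N).
  rewrite /s; elim: (N) => [|n IH].
    rewrite big_ord0 mul0r.
    by apply: eq_bounded_discrepancy (bounded_discrepancy0 R) => x; rewrite /Q andbF.
  rewrite big_ord_recr /= mulrDl.
  pose P x := coprime x 6 && (exponent_sum m x == n) && e n.
  have bP : bounded_discrepancy R (exponent_law R m n * (e n)%:R / 3) P.
    rewrite /P; case: (e n).
      rewrite mulr1; apply: eq_bounded_discrepancy (exponent_sum_discrepancy R m n) => x.
      by rewrite andbT.
    rewrite mulr0 mul0r.
    by apply: eq_bounded_discrepancy (bounded_discrepancy0 R) => x; rewrite andbF.
  apply: eq_bounded_discrepancy (bounded_discrepancy_add _ _ _ _ _ IH bP).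
    move=> x; rewrite /= /Q /P ltnS [(exponent_sum m x <= n)%N]leq_eqVlt.
    by case: coprime => //=; case: eqP => [->|]; rewrite ?ltnn //= orbF.
  by move=> x; rewrite /Q /P => /and3P[-> + _] /=; case: eqP => // ->; rewrite ltnn.
have [X hX] : exists X, forall x, (X <= x)%N -> Q N x -> A x.
  elim: (N) => [|n [X hX]]; first by exists 0%N => x _; rewrite /Q andbF.
  have [X' hX'] := hA n; exists (X + X')%N => x xX.
  rewrite /Q ltnS leq_eqVlt => /and3P[cx /orP[/eqP Kn|Kn] en]; last first.
    by apply: hX; [lia|rewrite /Q cx Kn en].
  apply/(hX' x) => //; [lia| |by rewrite -Kn].
  by split=> //; case: x cx {xX Kn en}.
have hQ := bounded_discrepancy_ge _ _ X bQ.
have : bounded_discrepancy R (s / 3) (fun x => x \in [set x | Q N x && (X <= x)%N]).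
  by apply: eq_bounded_discrepancy hQ => x; rewrite mem_setE.
move=> /density_ratio_cvg/cvgrPdist_le/(_ _ e20) hT.
near=> T.
have : density_ratio R [set x | Q N x && (X <= x)%N] T <= density_ratio R A T.
  by apply: density_ratio_le => x /= /andP[q xX]; apply: hX.
have : `|s - density_ratio R [set x | Q N x && (X <= x)%N] T| <= eps / 2.
  by near: T.
move: hN; rewrite !ler_norml; lra.
Unshelve. all: by end_near. Qed.

(** Truncation yields only lower bounds; the upper bound is the lower bound for the complement in
    [Pi6]. *)
Lemma density_cvg m e A : A `<=` Pi6 -> decided_by m e A ->
  density_ratio R A @ \oo --> mass R (exponent_law R m) e.
Proof.
move=> AP hA.
have hC : decided_by m (predC e) (Pi6 `\` A).
  move=> k; have [X hX] := hA k; exists X => x xX Px xk /=.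
  have := hX x xX Px xk; case: (e k) => h /=.
    by split=> // -[_]; case: h => _ /(_ isT).
  by split=> // _; split=> // /h.
apply/cvgrPdist_le => eps eps0; near=> T.
have : mass R (exponent_law R m) e - eps <= density_ratio R A T.
  by near: T; apply: density_ratio_lower.
have : mass R (exponent_law R m) (predC e) - eps <= density_ratio R (Pi6 `\` A) T.
  by near: T; apply: density_ratio_lower.
rewrite mass_predC ?density_ratio_setD//; last first.
- exact: exponent_law_is_law.
- by near: T; apply: nbhs_infty_gt.
rewrite ler_norml; lra.
Unshelve. all: by end_near. Qed.

Lemma density_prob m e A : A `<=` Pi6 -> decided_by m e A ->
  has_prob R A /\ prob R A = mass R (exponent_law R m) e.
Proof.
move=> AP hA; have h := density_cvg m e A AP hA.
by split; [apply/cvg_ex; exists (mass R (exponent_law R m) e)|apply: cvg_lim].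
Qed.

Lemma exponent_law_almost_invariant m : almost_invariant R (central_ratio R m)
  (fun e : pred int => mass R (exponent_law R m.+1) (fun k => e k%:Z)).
Proof.
apply: mass_almost_invariant; first exact: exponent_law_is_law.
exact: exponent_law_variation.
Qed.

End Density.

(** * The events of the theorem as arcs *)

Section Events.
Variable R : realType.
Implicit Types (B a b y : R).

Lemma mod1_sub_lt y a b : 0 <= a -> b <= 1 ->
  (mod1 (y - a) < b - a) = (a <= mod1 y < b).
Proof.
move=> a0 b1; apply/idP/idP => [h|/andP[h1 h2]].
  by have := mod1_lt_addr _ y a (b - a) a0; rewrite addrC subrK; apply.
by rewrite mod1B// ltrD2r.
Qed.

Lemma arcE B m a b (k : nat) :
  arc R (- logb B 2) ((2 * m)%:R * logb B 2 - a) (b - a) k%:Z =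
  (mod1 (((2 * m)%:R - k%:R) * logb B 2 - a) < b - a).
Proof. by rewrite /arc; congr (mod1 _ < _); rewrite -pmulrn; ring. Qed.

(* The error term is strictly positive after at least one step, so the limit
   point [b] of the closed interval is never attained: the arc is half-open. *)
Lemma decided_by_itv B m a b : 1 < B -> 0 <= a -> a <= b -> b <= 1 ->
  decided_by m.+1
    (fun k => arc R (- logb B 2) ((2 * m.+1)%:R * logb B 2 - a) (b - a) k%:Z)
    [set x0 | Pi6 x0 /\ a <= mod1 (log_ratio B m.+1 x0) <= b].
Proof.
move=> B1 a0 ab b1 k; rewrite arcE mod1_sub_lt//.
set y := ((2 * m.+1)%:R - k%:R) * logb B 2.
have /andP[y0 y1] := mod1_itv _ y.
(* The gap from [mod1 y] up to the next of [a], [b], 1, so that adding [t] crosses none of them. *)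
pose eta := if mod1 y < a then a - mod1 y else
  if mod1 y < b then b - mod1 y else 1 - mod1 y.
have eta0 : 0 < eta.
  by rewrite /eta; case: (ltP (mod1 y) a) => ?; last case: (ltP (mod1 y) b) => ?; lra.
have [X hX] := log_ratio_near R B m.+1 k eta B1 eta0.
exists X => x xX Px xk; have [t [lE /andP[t0 te] /(_ isT) tp]] := hX x xX Px xk.
have mE : mod1 (log_ratio B m.+1 x) = mod1 y + t.
  rewrite lE mod1D//; move: te; rewrite /eta.
  by case: (ltP (mod1 y) a) => ?; last case: (ltP (mod1 y) b) => ?; lra.
rewrite /= mE; move: te; rewrite /eta.
case: (ltP (mod1 y) a) => ya; first by move=> te; split=> [[_ /andP[]]|]//; lra.
case: (ltP (mod1 y) b) => yb te; last by split=> [[_ /andP[]]|]//; lra.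
by split=> // _; split=> //; apply/andP; split; lra.
Qed.

(** With no step taken the error is exactly 0, not positive, so closed endpoints need this separate
    treatment: every start has logarithm 0. *)
Lemma decided_by_itv0 B a b :
  decided_by 0 (fun _ => a <= mod1 (0 : R) <= b)
    [set x0 | Pi6 x0 /\ a <= mod1 (log_ratio B 0 x0) <= b].
Proof.
move=> k; exists 0%N => x _ Px _ /=.
rewrite /log_ratio expr0 mul1r /= divff ?pnatr_eq0 -?lt0n; last by case: Px.
by rewrite /logb ln1 mul0r; split=> [[]|].
Qed.

Lemma dist_int_le y (p : int) : dist_int y <= `|y - p%:~R|.
Proof.
apply: ge_inf; last by exists p.
by exists 0 => _ [q _ <-].
Qed.

Lemma dist_int_ge y c : (forall p : int, c <= `|y - p%:~R|) -> c <= dist_int y.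
Proof.
move=> h; apply: lb_le_inf; first by exists `|y - 0%:~R|, 0.
by move=> _ [p _ <-].
Qed.

(** The main term is a multiple of [1 / n]. If it is an integer the distance is [t < eps]; otherwise
    its fractional part lies in [[1 / n, 1 - 1 / n]], and [2 eps < 1 / n] keeps the distance above
    [eps]. *)
Lemma decided_by_dist_int n m j (eps : R) : (0 < n)%N ->
  0 < eps -> eps < 1 / (2 * n%:R) ->
  decided_by m
    (fun k => arc R (- n%:R^-1) (((2 * m)%:R - j%:R) / n%:R) n%:R^-1 k%:Z)
    [set x0 | Pi6 x0 /\ dist_int (log_ratio (2 ^+ n) m x0 - j%:R / n%:R) < eps].
Proof.
move=> n0 eps0 epsn k.
have n0' : 0 < n%:R :> R by rewrite ltr0n.
have B1 : 1 < 2 ^+ n :> R by rewrite exprn_egt1 ?ltr1n// -lt0n.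
have lbE : logb (2 ^+ n) 2 = n%:R^-1 :> R.
  rewrite /logb lnXn// -[_ *+ n]mulr_natl invfM mulrCA divff ?mulr1//.
  by rewrite gt_eqF// ln_gt0// ltr1n.
have [X hX] := log_ratio_near R _ m k eps B1 eps0.
exists X => x xX Px xk; have [t [lE /andP[t0 te] _]] := hX x xX Px xk.
pose z : int := (2 * m)%N%:Z - k%:Z - j%:Z.
have zE : z%:~R = (2 * m)%:R - k%:R - j%:R :> R by rewrite !intrB -!pmulrn.
have -> : arc R (- n%:R^-1) (((2 * m)%:R - j%:R) / n%:R) n%:R^-1 k%:Z =
    (mod1 (z%:~R / n%:R : R) < n%:R^-1).
  by rewrite /arc zE; congr (mod1 _ < _); rewrite -pmulrn; ring.
rewrite /= lE lbE.
have -> : ((2 * m)%:R - k%:R) / n%:R + t - j%:R / n%:R = z%:~R / n%:R + t.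
  by rewrite zE; ring.
have [q qE] := mod1E _ (z%:~R / n%:R : R).
have /andP[u0 u1] := mod1_itv _ (z%:~R / n%:R : R).
set u := mod1 _ in qE u0 u1 *.
have uE : n%:R * u = (z - q * n%:Z)%:~R.
  have -> : u = z%:~R / n%:R - q%:~R by rewrite qE addrK.
  by rewrite intrB intrM -pmulrn; field; rewrite gt_eqF.
have nV : n%:R * n%:R^-1 = 1 :> R by rewrite mulfV ?gt_eqF.
have e2 : 2 * eps < n%:R^-1.
  by move: epsn; rewrite div1r invfM -ltr_pdivlMl// mulrC.
split=> [[_ h]|h].
- rewrite ltNge; apply/negP => uge.
  move: h; apply/negP; rewrite -leNgt; apply: dist_int_ge => p.
  have u2 : u <= 1 - n%:R^-1.
    have : n%:R * u < n%:R by rewrite gtr_pMr.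
    rewrite uE -[n%:R]/(n%:Z%:~R) ltr_int => h.
    have : (z - q * n%:Z)%:~R <= (n%:Z - 1)%:~R :> R by rewrite ler_int; lia.
    rewrite -uE intrB -pmulrn => {}h.
    by rewrite -(ler_pM2l n0') [leRHS]mulrBr nV mulr1.
  rewrite qE; have [pq|pq] := leP p q.
    have : p%:~R <= q%:~R :> R by rewrite ler_int.
    by move=> ?; rewrite ger0_norm; lra.
  have : (q + 1)%:~R <= p%:~R :> R by rewrite ler_int; lia.
  by rewrite intrD => ?; rewrite ler0_norm; lra.
- split=> //; have u00 : u = 0.
    have : n%:R * u < 1 by rewrite -[ltRHS]nV ltr_pM2l.
    have : 0 <= n%:R * u by rewrite mulr_ge0// ltW.
    rewrite uE ler0z ltrz1 => h1 h2; have h3 : z - q * n%:Z = 0 by lia.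
    have : n%:R * u = 0 by rewrite uE h3.
    by move=> /eqP; rewrite mulf_eq0 gt_eqF//= => /eqP.
  apply: le_lt_trans (dist_int_le _ q) _.
  by rewrite qE u00 add0r addrAC subrr add0r ger0_norm.
Qed.

Lemma almost_invariant_le (eps eps' : R) S : eps <= eps' ->
  almost_invariant R eps S -> almost_invariant R eps' S.
Proof.
by move=> h [h1 h2 h3 h4]; split=> // e; apply: le_trans (h4 e) h.
Qed.

Lemma irrationalN y : irrational y -> irrational (- y).
Proof.
move=> h [q _ qE]; apply: h; exists (- q) => //.
by rewrite rmorphN /= qE opprK.
Qed.

End Events.

(** * Passage to the limit in the number of steps *)

Theorem theorem5p3 (R : realType) :
  (forall B : R, 1 < B ->
   forall kappa : R,
     irrational (logb B 2) -> dioph_type (logb B 2) = kappa%:E ->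
   forall a b : R, 0 <= a -> a <= b -> b <= 1 ->
   let A (m : nat) : set nat :=
     [set x0 | Pi6 x0 /\ a <= mod1 (log_ratio B m x0) <= b] in
   (forall m, has_prob R (A m)) /\
   prob R (A m) @[m --> \oo] --> b - a)
  /\
  (forall n : nat, (0 < n)%N ->
   forall j : nat, (j < n)%N ->
   forall eps : R, 0 < eps -> eps < 1 / (2 * n%:R) ->
   let A (m : nat) : set nat :=
     [set x0 | Pi6 x0 /\
        dist_int (log_ratio (2 ^+ n) m x0 - j%:R / n%:R) < eps] in
   (forall m, has_prob R (A m)) /\
   prob R (A m) @[m --> \oo] --> (1 / n%:R : R)).
Proof.
split.
- move=> B B1 kappa irr _ a b a0 ab b1 A.
  have AP m : A m `<=` Pi6 by move=> x [].
  split.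
    case=> [|m].
      by have [] := density_prob R _ _ _ (AP 0%N) (decided_by_itv0 R B a b).
    by have [] := density_prob R _ _ _ (AP m.+1) (decided_by_itv R B m a b B1 a0 ab b1).
  (* Shift to [m.+1], where the error is strictly positive and the law is [central_ratio m]-almost
     invariant. *)
  rewrite -cvg_shiftS; apply/cvgrPdist_le => eta eta0.
  have [eps eps0 heq] := equidistribution R _ eta (irrationalN R _ irr) eta0.
  have /cvgrPdist_le/(_ _ eps0) hc := central_ratio_cvg R.
  near=> m.
  have [_ pE] := density_prob R _ _ _ (AP m.+1) (decided_by_itv R B m a b B1 a0 ab b1).
  rewrite -[X in _ - X]/(prob R (A m.+1)) pE distrC.
  have cm : central_ratio R m <= eps.
    apply: le_trans (ler_norm _) _; rewrite -normrN -sub0r.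
    by near: m.
  apply: (heq _ (almost_invariant_le R _ _ _ cm (exponent_law_almost_invariant R m))).
  by apply/andP; split; lra.
- move=> n n0 j jn eps eps0 epsn A.
  have AP m : A m `<=` Pi6 by move=> x [].
  have AD m := density_prob R _ _ _ (AP m) (decided_by_dist_int R n m j eps n0 eps0 epsn).
  split; first by move=> m; have [] := AD m.
  rewrite -cvg_shiftS; apply/cvgrPdist_le => eta eta0.
  have n0' : 0 < n%:R :> R by rewrite ltr0n.
  (* The cyclic estimate multiplies the defect by [n]. *)
  have en0 : 0 < eta / n%:R by rewrite divr_gt0.
  have /cvgrPdist_le/(_ _ en0) hc := central_ratio_cvg R.
  near=> m.
  rewrite -[X in _ - X]/(prob R (A m.+1)) (AD m.+1).2 distrC div1r.
  have cm : central_ratio R m <= eta / n%:R.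
    apply: le_trans (ler_norm _) _; rewrite -normrN -sub0r.
    by near: m.
  have := equidistribution_cyclic R _ _ n
    (((2 * m.+1)%:R - j%:R) / n%:R) n0 (ltW en0)
    (almost_invariant_le R _ _ _ cm (exponent_law_almost_invariant R m)).
  by rewrite [n%:R * (eta / _)]mulrC divfK// gt_eqF.
Unshelve. all: by end_near. Qed.
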